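(* Let $k\ge d$. Let ${\mathbb S}=(\mathbf x_1,\dots,\mathbf x_{k-d})\sim D_{\mathcal X}^{k-d}$ and ${\mathbb S}_\circ=(\widetilde{\mathbf x}_1,\dots,\widetilde{\mathbf x}_d)\sim \mathrm{VS}_{D_{\mathcal X}}^d$ be independent, and let $\sigma$ be a uniformly random permutation of $\{1,\dots,k\}$, independent of both. Let $\widetilde{\mathbb S}\in(\mathbb R^d)^k$ be the $k$-tuple obtained by concatenating ${\mathbb S}$ and ${\mathbb S}_\circ$ and permuting the $k$ entries by $\sigma$. Then $\widetilde{\mathbb S}\sim \mathrm{VS}_{D_{\mathcal X}}^k$.
   Context: $D_{\mathcal X}$ is a probability distribution on $\mathbb R^d$ with $\mathbb E\|\mathbf x\|^2<\infty$ and $\boldsymbol\Sigma_{D_{\mathcal X}}:=\mathbb E[\mathbf x\mathbf x^\top]$ invertible. $D_{\mathcal X}^k$ denotes the law of $k$ i.i.d. draws from $D_{\mathcal X}$. For $k\ge d$, volume-rescaled sampling $\mathrm{VS}_{D_{\mathcal X}}^k$ is the probability measure on $(\mathbb R^d)^k$ defined for measurable $A\subseteq(\mathbb R^d)^k$ by $\mathrm{VS}_{D_{\mathcal X}}^k(A)=\dfrac{\mathbb E_{D_{\mathcal X}^k}\big[\mathbf 1_A\,\det\big(\sum_{i=1}^k\mathbf x_i\mathbf x_i^\top\big)\big]}{d!\binom{k}{d}\det(\boldsymbol\Sigma_{D_{\mathcal X}})}$. *)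

(* Defs.v *)
From HB Require Import structures.
From mathcomp Require Import all_boot all_order all_algebra.
From mathcomp Require Import fingroup perm.
From mathcomp Require Import all_classical all_reals all_analysis.
Set Implicit Arguments. Unset Strict Implicit. Unset Printing Implicit Defensive.
Import Order.TTheory GRing.Theory Num.Theory.
Local Open Scope classical_set_scope.
Local Open Scope ring_scope.

(* A point of R^d is a [d.-tuple R]
   (measurable structure: product sigma-algebra of the Borel sets of R,
   provided by the library), a k-tuple of points is a
   [k.-tuple (d.-tuple R)] with the product sigma-algebra. *)

Section VS.
Context {R : realType} {d : nat}.
Local Notation Pt := (d.-tuple R).
Variable D : probability Pt R.

(* E_{D^n}[f] for f : (R^d)^n -> [0,+oo], as the iterated integral
   \int D(dx_1) ... \int D(dx_n) f(x_1,...,x_n)  (Tonelli). *)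
Fixpoint iidE (n : nat) : (n.-tuple Pt -> \bar R) -> \bar R :=
  match n return (n.-tuple Pt -> \bar R) -> \bar R with
  | 0 => fun f => f [tuple]
  | n'.+1 => fun f => (\int[D]_x iidE (fun t => f (cons_tuple x t)))%E
  end.

Definition iidP (n : nat) (A : set (n.-tuple Pt)) : \bar R :=
  iidE (fun t => (\1_A t)%:E).

Definition SigmaD : 'M[R]_d :=
  \matrix_(a, b) fine (\int[D]_x ((tnth x a * tnth x b)%:E))%E.

Definition gram (n : nat) (t : n.-tuple Pt) : 'M[R]_d :=
  \matrix_(a, b) \sum_(i < n) tnth (tnth t i) a * tnth (tnth t i) b.

(* volume-rescaled sampling VS_D^n (meaningful for n >= d) *)
Definition VS (n : nat) (A : set (n.-tuple Pt)) : \bar R :=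
  (iidE (fun t => (\1_A t)%:E * (\det (gram t))%:E) *
   ((d`!%:R * 'C(n, d)%:R * \det SigmaD)^-1)%:E)%E.

End VS.

Definition concat_perm {R : realType} {d k : nat}
  (S : (k - d).-tuple (d.-tuple R)) (S0 : d.-tuple (d.-tuple R))
  (s : {perm 'I_k}) : k.-tuple (d.-tuple R) :=
  [tuple nth [tuple (0:R) | _ < d] (S ++ S0) (s i) | i < k].

(* Main.v *)
Require Import Defs.
From HB Require Import structures.
From mathcomp Require Import all_boot all_order all_algebra.
From mathcomp Require Import fingroup perm action primitive_action alt.
From mathcomp Require Import all_classical all_reals all_analysis.
From mathcomp Require Import measurable_realfun ring.
Import Order.TTheory GRing.Theory Num.Theory.
Set Implicit Arguments.
Unset Strict Implicit.
Unset Printing Implicit Defensive.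
Local Open Scope ring_scope.

(** Interleaving independent i.i.d. samples of sizes k - d and d along any
    bijection gives an i.i.d. sample of size k, because the i.i.d. law is
    determined by its values on boxes. Hence, on the event sigma = s, the
    permuted sample has a density with respect to the i.i.d. law of size k: up
    to a constant, the Gram determinant of the d entries coming from the
    volume-rescaled sample. By the Cauchy-Binet formula these determinants sum
    over all s to a multiple of the Gram determinant of the whole tuple. *)

Section PermCompInjective.
Variables (I T : finType) (e : I -> T).
Hypothesis e_inj : injective e.

Lemma exists_perm_comp_inj (f : I -> T) :
  injective f -> exists s : {perm T}, s \o e =1 f.
Proof.
move=> f_inj; have le_IT := leq_card e e_inj.
have dtuple_codom (g : I -> T) :
    injective g -> codom_tuple g \in #|I|.-dtuple([set: T]%SET).
  move=> g_inj; rewrite inE /= map_inj_uniq ?enum_uniq //.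
  exact/fintype.subsetP.
have Sym_ntrans := ntransitive_weak le_IT (Sym_trans T).
have [s _ sef] :=
  atransP2 Sym_ntrans (dtuple_codom e e_inj) (dtuple_codom f f_inj).
exists s => i; have /(congr1 val) := sef.
by rewrite /= -map_comp => /eq_in_map ->; rewrite ?mem_enum.
Qed.

Lemma card_perm_comp_inj (f : I -> T) : injective f ->
  #|[pred s : {perm T} | [forall i, s (e i) == f i]]| = (#|T| - #|I|)`!.
Proof.
move=> f_inj; have [u ue] := exists_perm_comp_inj f_inj.
have -> : (#|T| - #|I|)%N = #|[set x | x \notin codom e]|.
  by rewrite -(card_codom e_inj) -(cardC (mem (codom e))) addKn cardsE.
(* These permutations form the coset by u of those fixing codom e pointwise. *)
rewrite -card_perm -[RHS](card_imset _ (mulIg u)); apply: eq_card => s.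
rewrite inE; apply/forallP/imsetP => [se|[t te ->] i].
  exists (s * u^-1)%g; last by rewrite mulgKV.
  apply/fintype.subsetP => x; rewrite !inE; apply: contraNN => /codomP[i ->].
  by rewrite permM (eqP (se i)) -ue permK.
rewrite permM -ue (inj_eq perm_inj); apply: contraT => tei.
by have /fintype.subsetP/(_ (e i)) := te; rewrite !inE codom_f => /(_ tei).
Qed.

Lemma sum_perm_comp_inj (V : nmodType) (F : {ffun I -> T} -> V) :
  \sum_(s : {perm T}) F [ffun i => s (e i)] =
  (\sum_(f : {ffun I -> T} | injectiveb f) F f) *+ (#|T| - #|I|)`!.
Proof.
rewrite (partition_big (fun s : {perm T} => [ffun i => s (e i)])
  (fun f => injectiveb f)) /=; last first.
  by move=> s _; apply/injectiveP => i j; rewrite !ffunE => /perm_inj/e_inj.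
rewrite -sumrMnl; apply: eq_bigr => f /injectiveP f_inj.
rewrite (eq_bigr (fun=> F f)) => [|s /eqP-> //].
rewrite -(card_perm_comp_inj f_inj) -sumr_const; apply: eq_bigl => s.
rewrite !inE; apply/eqP/forallP => [<- i|se]; first by rewrite ffunE.
by apply/ffunP => i; rewrite ffunE; apply/eqP.
Qed.

End PermCompInjective.

Section CauchyBinet.
Variables (K : comNzRingType) (d n : nat).
Implicit Types (A : 'M[K]_(d, n)) (B : 'M[K]_(n, d)).

Lemma det_mulmx_sum_rowsub A B :
  \det (A *m B) =
  \sum_(f : {ffun 'I_d -> 'I_n}) (\prod_i A i (f i)) * \det (rowsub f B).
Proof.
rewrite /determinant; under [RHS]eq_bigr do rewrite big_distrr /=.
rewrite exchange_big; apply: eq_bigr => /= s _.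
under eq_bigr do rewrite mxE.
rewrite bigA_distr_bigA big_distrr /=; apply: eq_bigr => f _.
rewrite mulrCA big_split; congr (_ * (_ * _)).
by apply: eq_bigr => i _; rewrite mxE.
Qed.

Lemma det_rowsub_perm (f : 'I_d -> 'I_n) (s : 'S_d) B :
  \det (rowsub (f \o s) B) = (-1) ^+ s * \det (rowsub f B).
Proof. by rewrite rowsub_comp -row_permEsub row_permE det_mulmx det_perm. Qed.

Lemma det_rowsub_noninj (f : {ffun 'I_d -> 'I_n}) B :
  ~~ injectiveb f -> \det (rowsub f B) = 0.
Proof.
move=> /injectivePn[i [j ij fij]].
by apply: (determinant_alternate ij) => k; rewrite !mxE fij.
Qed.

(* Each maximal minor is counted d! times, once for each way of listing its
   rows; a map f that is not injective contributes 0. *)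
Lemma Cauchy_Binet A B :
  \sum_(f : {ffun 'I_d -> 'I_n}) \det (colsub f A) * \det (rowsub f B) =
  d`!%:R * \det (A *m B).
Proof.
rewrite -card_Sn mulr_natl -sumr_const.
under eq_bigr do rewrite [\det (colsub _ _)]/determinant mulr_suml.
rewrite exchange_big /=; apply: eq_bigr => s _.
pose reorder (u : 'S_d) (f : {ffun 'I_d -> 'I_n}) := [ffun i => f (u i)].
have reorderK : cancel (reorder s) (reorder s^-1%g).
  by move=> f; apply/ffunP => i; rewrite !ffunE permKV.
rewrite det_mulmx_sum_rowsub [RHS](reindex_inj (can_inj reorderK)) /=.
apply: eq_bigr => f _; rewrite mxsub_ffunl det_rowsub_perm mulrCA mulrA.
by congr (_ * _ * _); apply: eq_bigr => i _; rewrite mxE ffunE.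
Qed.

Lemma sum_perm_det_sub A B (e : 'I_d -> 'I_n) : injective e ->
  \sum_(s : 'S_n) \det (colsub (s \o e) A *m rowsub (s \o e) B) =
  (d`! * (n - d)`!)%:R * \det (A *m B).
Proof.
move=> e_inj; pose minors (f : {ffun 'I_d -> 'I_n}) :=
  \det (colsub f A) * \det (rowsub f B).
transitivity (\sum_(s : 'S_n) minors [ffun i => s (e i)]).
  apply: eq_bigr => s _.
  by rewrite /minors mxsub_ffunl mxsub_ffunr det_mulmx.
rewrite sum_perm_comp_inj // !card_ord -[LHS]mulr_natl natrM -mulrA.
rewrite mulrCA -Cauchy_Binet; congr (_ * _).
rewrite [RHS](bigID (fun f : {ffun _} => injectiveb f)) /=.
rewrite [X in _ + X]big1 ?addr0 // => f /det_rowsub_noninj ->.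
by rewrite mulr0.
Qed.

End CauchyBinet.

Local Open Scope classical_set_scope.

Lemma measurable_preimageT (d1 d2 : measure_display) (T1 : measurableType d1)
    (T2 : measurableType d2) (f : T1 -> T2) (Y : set T2) :
  measurable_fun setT f -> measurable Y -> measurable (f @^-1` Y).
Proof. by move=> mf mY; rewrite -[X in measurable X]setTI; exact: mf. Qed.

Section Fibers.
Context (dO : measure_display) (Omega : measurableType dO) (I : finType).
Variable sigma : Omega -> I.
Hypothesis msigma : forall i, measurable [set w | sigma w = i].

Lemma bigcup_fibers (E : I -> set Omega) :
  [set w | E (sigma w) w] =
  \bigcup_(i in [set: I]) (E i `&` [set w | sigma w = i]).
Proof.
apply/seteqP; split=> [w Ew|w [i _ [Ew /= wi]]]; first by exists (sigma w).
by rewrite /= wi.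
Qed.

Lemma measure_sum_fibers (R : realType) (P : {measure set Omega -> \bar R})
    (E : I -> set Omega) : (forall i, measurable (E i)) ->
  P [set w | E (sigma w) w] =
  (\sum_(i : I) P (E i `&` [set w | sigma w = i]))%E.
Proof.
move=> mE; rewrite bigcup_fibers measure_fin_bigcup.
- rewrite (fsbigE (index_enum I)) ?index_enum_uniq // => [|i _]; last first.
    by rewrite mem_index_enum.
  by apply: eq_bigl => i; rewrite in_setT.
- exact: finite_finset.
- by move=> i j _ _ [w [[_ <-] [_ <-]]].
- by move=> i _; exact: measurableI.
Qed.

End Fibers.

Lemma measure_preimage_pair_product (dO d1 d2 : measure_display)
    (Omega : measurableType dO) (T1 : measurableType d1)
    (T2 : measurableType d2) (R : realType)
    (P : {measure set Omega -> \bar R}) (X : Omega -> T1) (Y : Omega -> T2)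
    (E : set Omega) (m1 : {sigma_finite_measure set T1 -> \bar R})
    (m2 : {sigma_finite_measure set T2 -> \bar R}) :
  measurable_fun setT X -> measurable_fun setT Y -> measurable E ->
  (forall A B, measurable A -> measurable B ->
    P (X @^-1` A `&` Y @^-1` B `&` E) = m1 A * m2 B)%E ->
  forall C, measurable C ->
    P ((fun w => (X w, Y w)) @^-1` C `&` E) = (m1 \x m2)%E C.
Proof.
move=> mX mY mE PE C mC.
have mXY : measurable_fun setT (fun w => (X w, Y w)).
  exact: measurable_fun_pair.
apply/esym.
by apply: (product_measure_unique
  (m' := pushforward (mrestr P mE) (fun w => (X w, Y w)))).
Qed.

Lemma product_measure_density (d1 d2 : measure_display)
    (T1 : measurableType d1) (T2 : measurableType d2) (R : realType)
    (m1 : {sigma_finite_measure set T1 -> \bar R})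
    (m2 nu : {sigma_finite_measure set T2 -> \bar R}) (w : T2 -> \bar R) :
  measurable_fun setT w -> (forall y, 0 <= w y)%E ->
  (forall B, measurable B -> nu B = \int[m2]_(y in B) w y)%E ->
  forall C, measurable C ->
    ((m1 \x nu) C = \int[m1 \x m2]_(z in C) w z.2)%E.
Proof.
move=> mw w0 nuE C mC.
have mwC : measurable_fun setT ((w \o snd) \_ C).
  by apply/(measurable_restrictT _ mC); exact/measurable_funTS/measurableT_comp.
rewrite [RHS]integral_mkcond (fubini_tonelli1 _ mwC) => [|z]; last first.
  by rewrite patchE; case: ifP => //= _; exact: w0.
apply: eq_integral => x _ /=.
rewrite nuE; last exact: measurable_xsection.
rewrite integral_mkcond; apply: eq_integral => y _.
by rewrite !patchE mem_xsection.
Qed.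

Definition box (T : Type) (n : nat) (A : 'I_n -> set T) : set (n.-tuple T) :=
  [set t | forall i, A i (tnth t i)].

Section MeasurableBoxes.
Context (dT : measure_display) (T : measurableType dT) (n : nat).

Definition measurable_boxes : set (set (n.-tuple T)) :=
  [set box A | A in [set A : 'I_n -> set T | forall i, measurable (A i)]].

Lemma measurable_box (A : 'I_n -> set T) :
  (forall i, measurable (A i)) -> measurable (box A).
Proof.
move=> mA.
have -> : box A = \bigcap_(i in [set: 'I_n]) ((@tnth n T ^~ i) @^-1` A i).
  by apply/seteqP; split=> t /= At i; [move=> _|]; apply: At.
apply: fin_bigcap_measurable => // i _.
exact: measurable_preimageT (measurable_tnth i) (mA i).
Qed.

Lemma measurable_boxesT : measurable_boxes setT.
Proof. by exists (fun=> setT) => //; apply/seteqP; split. Qed.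

Lemma measurable_boxes_setI_closed : setI_closed measurable_boxes.
Proof.
move=> _ _ [A mA <-] [B mB <-]; exists (fun i => A i `&` B i).
  by move=> i; exact: measurableI.
apply/seteqP; split=> [t /= AB|t /= [At Bt] i]; last by split.
by split=> i; have [] := AB i.
Qed.

Lemma measurable_tuple_boxes :
  (measurable : set (set (n.-tuple T))) = <<s measurable_boxes >>.
Proof.
apply/seteqP; split; last first.
  apply: smallest_sub; first exact: sigma_algebra_measurable.
  by move=> _ [A mA <-]; exact: measurable_box.
apply: smallest_sub; first exact: smallest_sigma_algebra.
move=> A; rewrite -bigcup_seq => -[/= i _ [B mB <-]].
apply: sub_sigma_algebra; exists (fun j => if j == i then B else setT).
  by move=> j /=; case: ifP.
apply/seteqP; split=> [t /(_ i)|t [_ Bt] j] /=; first by rewrite eqxx.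
by case: eqP => // ->.
Qed.

Lemma finite_measure_boxes_unique (R : realType)
    (m1 : {finite_measure set (n.-tuple T) -> \bar R})
    (m2 : {measure set (n.-tuple T) -> \bar R}) :
  (forall A : 'I_n -> set T, (forall i, measurable (A i)) ->
    m1 (box A) = m2 (box A)) ->
  forall X, measurable X -> m1 X = m2 X.
Proof.
move=> m12; apply: (measure_unique measurable_boxes (fun=> setT)).
- exact: measurable_tuple_boxes.
- exact: measurable_boxes_setI_closed.
- by move=> _; exact: measurable_boxesT.
- by rewrite bigcup_const //; exists 0%N.
- by move=> _ [A mA <-]; exact: m12.
- by move=> _; rewrite -ge0_fin_numE ?fin_num_measure.
Qed.

End MeasurableBoxes.

Section IidLaw.
Context (dT : measure_display) (T : measurableType dT) (R : realType).
Variable mu : probability T R.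

Definition cons_pair n (z : T * n.-tuple T) : n.+1.-tuple T :=
  cons_tuple z.1 z.2.

Lemma measurable_cons_pair n : measurable_fun setT (@cons_pair n).
Proof. exact: (@measurable_cons _ _ _ _ fst n snd). Qed.

HB.instance Definition _ n :=
  isMeasurableFun.Build _ _ _ _ (@cons_pair n) (@measurable_cons_pair n).

Fixpoint iid_law n : probability (n.-tuple T) R :=
  if n is m.+1 then distribution (mu \x iid_law m)%E (@cons_pair m)
  else \d_[tuple].

Lemma preimage_cons_pair_box n (A : 'I_n.+1 -> set T) :
  @cons_pair n @^-1` box A = A ord0 `*` box (A \o lift ord0).
Proof.
apply/seteqP; split=> [[x t] /= At|[x t] /= [Ax At] i].
  by split=> [|i]; [have := At ord0; rewrite tnth0
                   |have := At (lift ord0 i); rewrite tnthS].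
by case: (unliftP ord0 i) => [j ->|->]; rewrite ?tnthS ?tnth0 //; exact: At.
Qed.

Lemma iid_law_box n (A : 'I_n -> set T) : (forall i, measurable (A i)) ->
  iid_law n (box A) = (\prod_(i < n) mu (A i))%E.
Proof.
elim: n A => [|n IHn] A mA /=.
  by rewrite big_ord0 diracE mem_set // => -[].
rewrite /distribution /pushforward preimage_cons_pair_box big_ord_recl.
have mlift : measurable (box (A \o lift ord0)).
  by apply: measurable_box => i; exact: mA.
by rewrite -IHn => [|i]; [exact: product_measure1E | exact: mA].
Qed.

Lemma iid_law_unique n (m : {measure set (n.-tuple T) -> \bar R}) :
  (forall A : 'I_n -> set T, (forall i, measurable (A i)) ->
    m (box A) = (\prod_(i < n) mu (A i))%E) ->
  forall X, measurable X -> iid_law n X = m X.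
Proof.
move=> m_box; apply: finite_measure_boxes_unique => A mA.
by rewrite m_box //; exact: iid_law_box.
Qed.

End IidLaw.

Definition subsample (T : Type) (m n : nat) (f : 'I_m -> 'I_n)
    (t : n.-tuple T) : m.-tuple T :=
  [tuple tnth t (f j) | j < m].

Lemma measurable_subsample (dT : measure_display) (T : measurableType dT)
    (m n : nat) (f : 'I_m -> 'I_n) :
  measurable_fun setT (@subsample T m n f).
Proof.
apply/measurable_fun_tnthP => j; rewrite /comp /subsample.
by under eq_fun do rewrite tnth_mktuple; exact: measurable_tnth.
Qed.

Section Interleave.
Variables (T : Type) (m n k : nat).
Variables (source : 'I_k -> 'I_m + 'I_n) (target : 'I_m + 'I_n -> 'I_k).

Definition interleave (z : m.-tuple T * n.-tuple T) : k.-tuple T :=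
  [tuple match source i with
         | inl a => tnth z.1 a
         | inr b => tnth z.2 b
         end | i < k].

Hypothesis targetK : cancel target source.

Lemma subsample_interleave z :
  subsample (target \o inr) (interleave z) = z.2.
Proof. by apply: eq_from_tnth => j; rewrite !tnth_mktuple targetK. Qed.

Lemma preimage_interleave_box (A : 'I_k -> set T) : cancel source target ->
  interleave @^-1` box A =
  box (A \o target \o inl) `*` box (A \o target \o inr).
Proof.
move=> sourceK; apply/seteqP; split=> [[x y] /= At|[x y] /= [Ax Ay] i].
  by split=> j /=; [have := At (target (inl j)) | have := At (target (inr j))];
    rewrite tnth_mktuple targetK.
rewrite tnth_mktuple -[in A i](sourceK i).
by case: (source i) => j; [exact: Ax | exact: Ay].
Qed.

End Interleave.

Section IidLawInterleave.
Context (dT : measure_display) (T : measurableType dT) (R : realType).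
Variables (mu : probability T R) (m n k : nat).
Variables (source : 'I_k -> 'I_m + 'I_n) (target : 'I_m + 'I_n -> 'I_k).

Lemma measurable_interleave : measurable_fun setT (@interleave T _ _ _ source).
Proof.
apply/measurable_fun_tnthP => i; rewrite /comp /interleave.
under eq_fun do rewrite tnth_mktuple.
by case: (source i) => j; exact: (measurableT_comp (measurable_tnth j)).
Qed.

HB.instance Definition _ := isMeasurableFun.Build _ _ _ _
  (@interleave T _ _ _ source) measurable_interleave.

Hypotheses (sourceK : cancel source target) (targetK : cancel target source).

Lemma iid_law_interleave X : measurable X ->
  iid_law mu k X =
  distribution (iid_law mu m \x iid_law mu n)%E (interleave source) X.
Proof.
apply: iid_law_unique => A mA.
rewrite /distribution /pushforward /= (preimage_interleave_box targetK) //.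
rewrite [LHS]product_measure1E; try by apply: measurable_box => i; exact: mA.
rewrite (reindex target) /=; last by exists source => i _.
by rewrite big_sumType /=; congr (_ * _)%E; apply: iid_law_box => i; exact: mA.
Qed.

Lemma product_interleave_density
    (nu : {sigma_finite_measure set (n.-tuple T) -> \bar R})
    (w : n.-tuple T -> \bar R) :
  measurable_fun setT w -> (forall y, 0 <= w y)%E ->
  (forall B, measurable B -> nu B = \int[iid_law mu n]_(y in B) w y)%E ->
  forall A, measurable A ->
  ((iid_law mu m \x nu) (interleave source @^-1` A) =
   \int[iid_law mu k]_(t in A) w (subsample (target \o inr) t))%E.
Proof.
move=> mw w0 nuE A mA.
pose w_sub (t : k.-tuple T) := w (subsample (target \o inr) t).
have mw_sub : measurable_fun A w_sub.
  apply/measurable_funTS/(measurableT_comp mw); exact: measurable_subsample.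
rewrite (product_measure_density _ mw w0 nuE); last first.
  exact: measurable_preimageT measurable_interleave mA.
transitivity (\int[distribution (iid_law mu m \x iid_law mu n)
    (interleave source)]_(t in A) w_sub t)%E; last first.
  apply: eq_measure_integral => X mX _; apply/esym.
  exact: iid_law_interleave.
rewrite (ge0_integral_pushforward measurable_interleave) //; last first.
  by move=> t _; exact: w0.
by apply: eq_integral => z _; rewrite /= /w_sub subsample_interleave.
Qed.

End IidLawInterleave.

Section IidExpectation.
Context (R : realType) (d : nat) (D : probability (d.-tuple R) R).

Lemma iidE_iid_law n (f : n.-tuple (d.-tuple R) -> \bar R) :
  measurable_fun setT f -> (forall t, 0 <= f t)%E ->
  iidE D f = (\int[iid_law D n]_t f t)%E.
Proof.
elim: n f => [|n IHn] f mf f0 /=.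
  by rewrite integral_dirac // diracT mul1e.
have mf_cons : measurable_fun setT (f \o @cons_pair _ _ n).
  exact: measurableT_comp.
rewrite ge0_integral_distribution // (fubini_tonelli1 _ mf_cons (fun=> f0 _)).
apply: eq_integral => x _; apply: IHn => //; apply: measurableT_comp => //.
exact: (measurable_fun_pair2 _ (@measurable_cons_pair _ _ n)).
Qed.

Lemma iidP_iid_law n (A : set (n.-tuple (d.-tuple R))) :
  measurable A -> iidP D A = iid_law D n A.
Proof.
move=> mA; rewrite /iidP iidE_iid_law.
- by rewrite integral_indic // setIT.
- exact/measurable_EFinP/measurable_indic.
- by move=> t; rewrite lee_fin.
Qed.

End IidExpectation.

Section Gram.
Context (R : realType) (d : nat).
Local Notation Pt := (d.-tuple R).

Definition rows_mx n (t : n.-tuple Pt) : 'M[R]_(n, d) :=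
  \matrix_(i, a) tnth (tnth t i) a.

Lemma gramE n (t : n.-tuple Pt) : gram t = (rows_mx t)^T *m rows_mx t.
Proof.
by apply/matrixP => a b; rewrite !mxE; apply: eq_bigr => i _; rewrite !mxE.
Qed.

Lemma rows_mx_subsample m n (f : 'I_m -> 'I_n) (t : n.-tuple Pt) :
  rows_mx (subsample f t) = rowsub f (rows_mx t).
Proof. by apply/matrixP => i a; rewrite !mxE tnth_mktuple. Qed.

Lemma det_gram_ge0 n (t : n.-tuple Pt) : 0 <= \det (gram t).
Proof.
have d_fact_gt0 : 0 < d`!%:R :> R by [].
rewrite -(pmulr_rge0 _ d_fact_gt0) gramE -Cauchy_Binet.
by apply: sumr_ge0 => f _; rewrite -trmx_mxsub det_tr -expr2 sqr_ge0.
Qed.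

Lemma sum_perm_det_gram n (t : n.-tuple Pt) (e : 'I_d -> 'I_n) :
  injective e ->
  \sum_(s : 'S_n) \det (gram (subsample (s \o e) t)) =
  (d`! * (n - d)`!)%:R * \det (gram t).
Proof.
move=> e_inj; rewrite gramE -(sum_perm_det_sub _ _ e_inj).
by apply: eq_bigr => s _; rewrite gramE rows_mx_subsample trmx_mxsub.
Qed.

Lemma measurable_det_gram n :
  measurable_fun setT (fun t : n.-tuple Pt => \det (gram t)).
Proof.
apply: measurable_sum => s; apply: measurable_funM => //.
apply: measurable_prod => a _.
under eq_fun do rewrite mxE.
apply: measurable_sum => i.
by apply: measurable_funM; apply: (measurableT_comp (measurable_tnth _));
  exact: measurable_tnth.
Qed.

End Gram.

Section VolumeSampling.
Context (R : realType) (d : nat) (D : probability (d.-tuple R) R).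
Local Notation Pt := (d.-tuple R).

Definition vs_density n (t : n.-tuple Pt) : R :=
  \det (gram t) / (d`!%:R * 'C(n, d)%:R * \det (SigmaD D)).

Lemma measurable_vs_density n : measurable_fun setT (@vs_density n).
Proof. by apply: measurable_funM => //; exact: measurable_det_gram. Qed.

Lemma vs_density_ge0 n (t : n.-tuple Pt) :
  0 <= \det (SigmaD D) -> 0 <= vs_density t.
Proof. by move=> Sigma_ge0; rewrite divr_ge0 ?det_gram_ge0 // !mulr_ge0. Qed.

Lemma sum_perm_vs_density n (t : n.-tuple Pt) (e : 'I_d -> 'I_n) :
  injective e ->
  \sum_(s : 'S_n) vs_density (subsample (s \o e) t) = n`!%:R * vs_density t.
Proof.
move=> e_inj; have le_dn := leq_card e e_inj; rewrite !card_ord in le_dn.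
rewrite -mulr_suml sum_perm_det_gram // /vs_density binn mulr1.
rewrite -(bin_fact le_dn) !natrM !invfM.
(* Opaque to [field], which would otherwise require it to be nonzero. *)
set invSigma := (\det (SigmaD D))^-1.
have d_fact_neq0 : d`!%:R != 0 :> R by [].
have bin_neq0 : 'C(n, d)%:R != 0 :> R by rewrite pnatr_eq0 -lt0n bin_gt0.
by field; exact/andP.
Qed.

Lemma VS_integral_det_gram n (A : set (n.-tuple Pt)) : measurable A ->
  VS D A = (\int[iid_law D n]_(t in A) (\det (gram t))%:E *
            ((d`!%:R * 'C(n, d)%:R * \det (SigmaD D))^-1)%:E)%E.
Proof.
move=> mA; rewrite /VS iidE_iid_law.
- rewrite [in RHS]integral_mkcond; congr (_ * _)%E; apply: eq_integral => t _.
  by rewrite patchE indicE; case: ifP => _; rewrite ?mul1e ?mul0e.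
- apply: emeasurable_funM; apply/measurable_EFinP.
  + exact: measurable_indic.
  + exact: measurable_det_gram.
- by move=> t; rewrite mule_ge0 // lee_fin ?det_gram_ge0.
Qed.

Lemma VS_gt0_det_SigmaD_gt0 n (A : set (n.-tuple Pt)) :
  measurable A -> (0 < VS D A)%E -> 0 < \det (SigmaD D).
Proof.
move=> mA; rewrite VS_integral_det_gram // !ltNge; apply: contra => Sigma_le0.
apply: mule_ge0_le0.
  by apply: integral_ge0 => t _; rewrite lee_fin det_gram_ge0.
by rewrite lee_fin invr_le0 mulr_ge0_le0.
Qed.

Lemma VS_integral_density n (A : set (n.-tuple Pt)) :
  0 <= \det (SigmaD D) -> measurable A ->
  VS D A = (\int[iid_law D n]_(t in A) (vs_density t)%:E)%E.
Proof.
move=> Sigma_ge0 mA; rewrite VS_integral_det_gram // -ge0_integralZr //.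
- by apply/measurable_funTS/measurable_EFinP; exact: measurable_det_gram.
- by move=> t _; rewrite lee_fin det_gram_ge0.
- by rewrite lee_fin invr_ge0 !mulr_ge0.
Qed.

Lemma VS_uniform_mixture n (e : 'I_d -> 'I_n) (A : set (n.-tuple Pt)) :
  0 <= \det (SigmaD D) -> injective e -> measurable A ->
  VS D A = (\sum_(s : 'S_n) \int[iid_law D n]_(t in A)
    (n`!%:R^-1 * vs_density (subsample (s \o e) t))%:E)%E.
Proof.
move=> Sigma_ge0 e_inj mA; rewrite VS_integral_density // -ge0_integral_sum //.
- apply: eq_integral => t _; rewrite sumEFin -mulr_sumr sum_perm_vs_density //.
  by rewrite mulKf.
- move=> s; apply/measurable_funTS/measurable_EFinP/measurable_funM => //.
  apply: (measurableT_comp (@measurable_vs_density d)).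
  exact: measurable_subsample.
- by move=> s t _; rewrite lee_fin mulr_ge0 ?vs_density_ge0.
Qed.

End VolumeSampling.

Section ConcatPerm.
Context (R : realType) (d k : nat).
Hypothesis le_dk : (d <= k)%N.

Definition volume_slot (b : 'I_d) : 'I_k :=
  cast_ord (subnK le_dk) (rshift (k - d) b).

Lemma volume_slot_inj : injective volume_slot.
Proof. by move=> a b /cast_ord_inj /rshift_inj. Qed.

Definition concat_source (s : 'S_k) (i : 'I_k) : 'I_(k - d) + 'I_d :=
  fintype.split (cast_ord (esym (subnK le_dk)) (s i)).

Definition concat_target (s : 'S_k) (j : 'I_(k - d) + 'I_d) : 'I_k :=
  (s^-1)%g (cast_ord (subnK le_dk) (unsplit j)).

Lemma concat_sourceK s : cancel (concat_source s) (concat_target s).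
Proof.
by move=> i; rewrite /concat_target /concat_source splitK cast_ordKV permK.
Qed.

Lemma concat_targetK s : cancel (concat_target s) (concat_source s).
Proof.
by move=> j; rewrite /concat_target /concat_source permKV cast_ordK unsplitK.
Qed.

Lemma concat_permE (S : (k - d).-tuple (d.-tuple R)) S0 (s : 'S_k) :
  concat_perm S S0 s = interleave (concat_source s) (S, S0).
Proof.
apply: eq_from_tnth => i.
rewrite !tnth_mktuple /concat_source nth_cat size_tuple.
by case: split_ordP => j /(congr1 val) /= ->;
  rewrite ?ltn_ord ?(ltnNge, leq_addr) /= ?addKn -tnth_nth.
Qed.

Lemma measurable_concat_perm (dO : measure_display) (Omega : measurableType dO)
    (S : Omega -> (k - d).-tuple (d.-tuple R))
    (S0 : Omega -> d.-tuple (d.-tuple R)) (s : 'S_k) :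
  measurable_fun setT S -> measurable_fun setT S0 ->
  measurable_fun setT (fun w => concat_perm (S w) (S0 w) s).
Proof.
move=> mS mS0; under eq_fun do rewrite concat_permE.
apply: (measurableT_comp (@measurable_interleave _ _ _ _ _ _)).
exact: measurable_fun_pair.
Qed.

End ConcatPerm.

Section PermutedSample.
Context (R : realType) (d k : nat) (D : probability (d.-tuple R) R)
  (dO : measure_display) (Omega : measurableType dO) (P : probability Omega R).
Variables (S : Omega -> (k - d).-tuple (d.-tuple R))
  (S0 : Omega -> d.-tuple (d.-tuple R)) (sigma : Omega -> 'S_k).
Hypotheses (le_dk : (d <= k)%N)
  (mS : measurable_fun setT S) (mS0 : measurable_fun setT S0)
  (msigma : forall s, measurable [set w | sigma w = s]).
Hypothesis joint_law : forall A B s, measurable A -> measurable B ->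
  P (S @^-1` A `&` S0 @^-1` B `&` [set w | sigma w = s]) =
  (iidP D A * VS D B * (k`!%:R^-1)%:E)%E.

Lemma law_volume_sample B : measurable B -> P (S0 @^-1` B) = VS D B.
Proof.
move=> mB; have mS0B := measurable_preimageT mS0 mB.
rewrite (measure_sum_fibers msigma P (E := fun=> S0 @^-1` B)) //.
transitivity (\sum_(s : 'S_k) VS D B * (k`!%:R^-1)%:E)%E.
  apply: eq_bigr => s _; have := joint_law s measurableT mB.
  by rewrite iidP_iid_law // probability_setT mul1e preimage_setT setTI.
rewrite -ge0_sume_distrr => [|s _]; last by rewrite lee_fin invr_ge0.
by rewrite sumEFin sumr_const card_Sn -[_ *+ _]mulr_natl mulfV ?mule1.
Qed.

Lemma det_SigmaD_gt0 : 0 < \det (SigmaD D).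
Proof.
apply: (@VS_gt0_det_SigmaD_gt0 _ _ _ d setT) => //.
by rewrite -law_volume_sample // preimage_setT probability_setT.
Qed.

Lemma law_concat_perm_fiber s A : measurable A ->
  P ((fun w => concat_perm (S w) (S0 w) s) @^-1` A `&` [set w | sigma w = s]) =
  (\int[iid_law D k]_(t in A) (k`!%:R^-1 *
    vs_density D (subsample (s^-1%g \o volume_slot le_dk) t))%:E)%E.
Proof.
move=> mA; have Sigma_ge0 := ltW det_SigmaD_gt0.
pose w (y : d.-tuple (d.-tuple R)) := (k`!%:R^-1 * vs_density D y)%:E.
have mw : measurable_fun setT w.
  by apply/measurable_EFinP/measurable_funM => //; exact: measurable_vs_density.
have w_ge0 y : (0 <= w y)%E by rewrite lee_fin mulr_ge0 ?vs_density_ge0.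
pose S0_law := distribution P (mfun_Sub (mem_set mS0) : {mfun _ >-> _}).
have inv_fact_ge0 : 0 <= k`!%:R^-1 :> R by rewrite invr_ge0.
pose nu := mscale (NngNum inv_fact_ge0) S0_law.
have nuE B : measurable B -> nu B = ((k`!%:R^-1)%:E * VS D B)%E.
  by move=> mB; rewrite -law_volume_sample.
have nu_density B : measurable B ->
    (nu B = \int[iid_law D d]_(y in B) w y)%E.
  move=> mB; rewrite nuE // VS_integral_density // -ge0_integralZl //.
  - apply/measurable_funTS/measurable_EFinP; exact: measurable_vs_density.
  - by move=> y _; rewrite lee_fin vs_density_ge0.
under eq_fun do rewrite concat_permE.
rewrite -(product_interleave_density (concat_sourceK le_dk s)
  (concat_targetK le_dk s) mw w_ge0 nu_density mA).
apply: (measure_preimage_pair_product mS mS0 (msigma s)) => [B C mB mC|].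
  rewrite [LHS](joint_law s mB mC) iidP_iid_law // -muleA (muleC (VS D C)).
  by rewrite -nuE.
exact: measurable_preimageT (@measurable_interleave _ _ _ _ _ _) mA.
Qed.

End PermutedSample.

Theorem theorem1 (R : realType) (d k : nat)
  (D : probability (d.-tuple R) R)
  (hint : forall a : 'I_d,
     D.-integrable [set: d.-tuple R] (fun x => ((tnth x a) ^+ 2)%:E))
  (hSigma : \det (SigmaD D) != 0)
  (hkd : (d <= k)%N)
  (dO : measure_display) (Omega : measurableType dO)
  (P : probability Omega R)
  (S : Omega -> (k - d).-tuple (d.-tuple R))
  (S0 : Omega -> d.-tuple (d.-tuple R))
  (sigma : Omega -> {perm 'I_k})
  (mS : measurable_fun [set: Omega] S)
  (mS0 : measurable_fun [set: Omega] S0)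
  (msigma : forall s : {perm 'I_k}, measurable [set w | sigma w = s])
  (hlaw : forall (A : set ((k - d).-tuple (d.-tuple R)))
                 (B : set (d.-tuple (d.-tuple R))) (s : {perm 'I_k}),
     measurable A -> measurable B ->
     P (S @^-1` A `&` S0 @^-1` B `&` [set w | sigma w = s]) =
     (iidP D A * VS D B * ((k`!)%:R^-1)%:E)%E) :
  forall A : set (k.-tuple (d.-tuple R)), measurable A ->
    P ((fun w => concat_perm (S w) (S0 w) (sigma w)) @^-1` A) = VS D A.
Proof.
move=> A mA; have Sigma_gt0 := det_SigmaD_gt0 mS0 msigma hlaw.
rewrite (VS_uniform_mixture (ltW Sigma_gt0) (@volume_slot_inj _ _ hkd) mA).
rewrite (reindex_inj invg_inj) /=.
rewrite (measure_sum_fibers msigma P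
  (E := fun s => (fun w => concat_perm (S w) (S0 w) s) @^-1` A)) => [|s].
  by apply: eq_bigr => s _; exact: law_concat_perm_fiber.
by apply: measurable_preimageT mA; exact: measurable_concat_perm.
Qed.
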